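(* Let $\delta\in\mathbb{C}$. The partial differential system in two variables $(t,s)$ $$\begin{aligned} dx=&\left\{-\tfrac32(\sqrt5-1)x^2+y\right\}dt+\left\{-12(\sqrt5+2)x^2y+(\sqrt5+1)\left(3xz-2y^2-\tfrac23\delta\right)\right\}ds,\\ dy=&\;z\,dt+\left\{-6(2\sqrt5-5)x^2z+12\sqrt5\,xy^2-(\sqrt5+1)yz+(3\sqrt5-5)\delta x\right\}ds,\\ dz=&\left\{3(\sqrt5+3)y^2+3(\sqrt5-1)xz+\delta\right\}dt+\left\{48xyz-24y^3-(\sqrt5+1)z^2+2(\sqrt5-3)\delta y\right\}ds \end{aligned}$$ satisfies the compatibility condition $$\frac{\partial}{\partial s}\frac{\partial x}{\partial t}=\frac{\partial}{\partial t}\frac{\partial x}{\partial s},\qquad \frac{\partial}{\partial s}\frac{\partial y}{\partial t}=\frac{\partial}{\partial t}\frac{\partial y}{\partial s},\qquad \frac{\partial}{\partial s}\frac{\partial z}{\partial t}=\frac{\partial}{\partial t}\frac{\partial z}{\partial s}.$$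
   Context: Here $x,y,z$ are unknown complex functions of $(t,s)$; the coefficient of $dt$ (resp. $ds$) in $dx,dy,dz$ prescribes $\partial x/\partial t,\partial y/\partial t,\partial z/\partial t$ (resp. $\partial x/\partial s,\partial y/\partial s,\partial z/\partial s$) as polynomials in $x,y,z$. In the compatibility condition, the second derivatives are computed by the chain rule using these prescribed first derivatives, and the equalities are identities of polynomials in $x,y,z$ (equivalently, the two polynomial vector fields on $\mathbb{C}^3$ commute). *)

(* Defs.v *)
From mathcomp Require Import all_boot all_order all_algebra.
From mathcomp Require Import complex mpoly.
From mathcomp Require Import reals.

Set Implicit Arguments.
Unset Strict Implicit.
Unset Printing Implicit Defensive.

Import Order.TTheory GRing.Theory Num.Theory.

Local Open Scope ring_scope.

(* Chain rule: for p a polynomial in (x, y, z) = ('X_0, 'X_1, 'X_2), the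
   derivative of p in a direction along which the derivatives of x, y, z are
   prescribed to be the polynomials dx, dy, dz; the result is again a polynomial
   in x, y, z. *)
Definition chain_deriv (K : comNzRingType) (dx dy dz p : {mpoly K[3]}) :
    {mpoly K[3]} :=
  p^`M(0) * dx + p^`M(1) * dy + p^`M(2%:R) * dz.

(* The compatibility condition of the system
     d(x, y, z) = (xt, yt, zt) dt + (xs, ys, zs) ds,
   as identities of polynomials in x, y, z. *)
Definition compatible (K : comNzRingType) (xt yt zt xs ys zs : {mpoly K[3]}) :
    Prop :=
  let d_dt := chain_deriv xt yt zt in
  let d_ds := chain_deriv xs ys zs in
  [/\ d_ds xt = d_dt xs, d_ds yt = d_dt ys & d_ds zt = d_dt zs].

(* Main.v *)
Require Import Defs.
From mathcomp Require Import all_boot all_order all_algebra.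
From mathcomp Require Import complex mpoly.
From mathcomp Require Import reals.
From mathcomp Require Import ring.

(** A derivation of C[x, y, z] is determined by its values on x, y, z, so both
    sides of each equality can be computed with the Leibniz rule alone, which
    gives two explicit polynomials whose coefficients are polynomials in
    sqrt 5, delta, 3/2 and 2/3. These polynomials agree modulo the relations
    sqrt 5 ^ 2 = 5, 2 * (3/2) = 3 and 3 * (2/3) = 2, while delta stays free.
    Hence the proof has two parts: the derivation laws of [chain_deriv], which
    evaluate both sides, and a comparison modulo these relations in which
    sqrt 5, 3/2 and 2/3 are opaque elements of a commutative ring. Nothing
    else about sqrt 5 enters, so its conjugate - sqrt 5 would serve as well.

    The system is quasi-homogeneous when x, y, z, delta get the weights
    1, 2, 3, 4, and so do the two sides of each equality: the weight is 5 for
    x, 6 for y and 7 for z, which leaves few monomials to compare. *)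

Import Order.TTheory GRing.Theory Num.Theory.

Local Open Scope ring_scope.
Local Open Scope complex_scope.

Section ChainDeriv.
Variables (K : comNzRingType) (dx dy dz : {mpoly K[3]}).
Local Notation D := (chain_deriv dx dy dz).

Lemma chain_derivD p q : D (p + q) = D p + D q.
Proof. by rewrite /chain_deriv !mderivD; ring. Qed.

Lemma chain_derivN p : D (- p) = - D p.
Proof. by rewrite /chain_deriv !mderivN; ring. Qed.

Lemma chain_derivM p q : D (p * q) = D p * q + p * D q.
Proof. by rewrite /chain_deriv !mderivM; ring. Qed.

Lemma chain_derivC c : D c%:MP = 0.
Proof. by rewrite /chain_deriv !mderivC; ring. Qed.

Lemma chain_deriv_nat n : D n%:R = 0.
Proof. by rewrite -mpolyC_nat chain_derivC. Qed.

Lemma chain_deriv1 : D 1 = 0.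
Proof. exact: (chain_deriv_nat 1). Qed.

Lemma chain_derivX p n : D (p ^+ n) = n%:R * p ^+ n.-1 * D p.
Proof.
elim: n => [|n IHn]; first by rewrite expr0 chain_deriv1 !mul0r.
rewrite exprS chain_derivM IHn /=; case: n {IHn} => [|n] /=; first by ring.
by rewrite !exprS -!natr1; ring.
Qed.

Lemma chain_deriv_var :
  (D 'X_0 = dx) * (D 'X_1 = dy) * (D 'X_(2%:R) = dz).
Proof.
have dX (i j : 'I_3) : ('X_j : {mpoly K[3]})^`M(i) = (j == i)%:R.
  rewrite mderivX mnm1E; case: eqVneq => [->|_]; last by rewrite scale0r.
  by rewrite -{1}[U_(i)%MM]add0m addmK mpolyX0 scale1r.
by rewrite /chain_deriv !dX /=; split; [split|]; ring.
Qed.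

End ChainDeriv.

Theorem proposition10p2 (R : realType) (delta : R[i]) :
  let x : {mpoly R[i][3]} := 'X_0 in
  let y : {mpoly R[i][3]} := 'X_1 in
  let z : {mpoly R[i][3]} := 'X_(2%:R) in
  let s5 : {mpoly R[i][3]} := ((Num.sqrt (5 : R))%:C)%:MP in
  let d : {mpoly R[i][3]} := delta%:MP in
  let q (c : R[i]) : {mpoly R[i][3]} := c%:MP in
  compatible
    (- q (3 / 2) * (s5 - 1) * x ^+ 2 + y)
    z
    (3 * (s5 + 3) * y ^+ 2 + 3 * (s5 - 1) * x * z + d)
    (- 12 * (s5 + 2) * x ^+ 2 * y
       + (s5 + 1) * (3 * x * z - 2 * y ^+ 2 - q (2 / 3) * d))
    (- 6 * (2 * s5 - 5) * x ^+ 2 * z + 12 * s5 * x * y ^+ 2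
       - (s5 + 1) * y * z + (3 * s5 - 5) * d * x)
    (48 * x * y * z - 24 * y ^+ 3 - (s5 + 1) * z ^+ 2
       + 2 * (s5 - 3) * d * y).
Proof.
move=> x y z s5 d q.
have s5sq : s5 ^+ 2 = 5.
  rewrite -rmorphXn /= -(rmorphXn (@real_complex R)) /= sqr_sqrtr ?ler0n //.
  by rewrite rmorph_nat mpolyC_nat.
have qE m n : n.+1%:R * q (m%:R / n.+1%:R) = m%:R.
  rewrite mulr_natl -mpolyCMn -[(_ / _) *+ _]mulr_natr divfK ?pnatr_eq0 //.
  exact: mpolyC_nat.
have q32 : 2 * q (3 / 2) = 3 := qE 3 1.
have q23 : 3 * q (2 / 3) = 2 := qE 2 2.
have Dconst f g h :
    (chain_deriv f g h s5 = 0) * (chain_deriv f g h d = 0)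
    * (chain_deriv f g h (q (3 / 2)) = 0)
    * (chain_deriv f g h (q (2 / 3)) = 0).
  by rewrite !chain_derivC.
have Dvar f g h :
    (chain_deriv f g h x = f) * (chain_deriv f g h y = g)
    * (chain_deriv f g h z = h) := chain_deriv_var _ f g h.
move: (q (3 / 2)) (q (2 / 3)) q32 q23 Dconst => u v u_def v_def Dconst.
(* The cofactors a and b of the relations for 3/2 and 2/3 have to be given,
   since 2 and 3 are not units among the integer coefficients; sqrt 5 ^ 2 = 5
   is monic and can be used as a rewriting rule. *)
have modulo_uv a b p p' :
    p = p' + (2 * u - 3) * a + (3 * v - 2) * b -> p = p'.
  by rewrite u_def v_def !subrr !mul0r !addr0.
rewrite /compatible !(chain_derivD, chain_derivN, chain_derivM, chain_derivX,
  chain_deriv_nat, chain_deriv1, Dconst, Dvar) /=.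
clear Dvar Dconst u_def v_def; clearbody x y z s5 d.
split.
- apply: (modulo_uv (- 6 * x ^+ 2 * z + 8 * x * y ^+ 2 + 4 * v * d * x)
                    (4 * d * x)).
  ring: s5sq.
- apply: (modulo_uv ((42 * s5 - 90) * x ^+ 3 * z
                     + (30 - 6 * s5) * x ^+ 2 * y ^+ 2
                     + (10 - 4 * s5) * d * x ^+ 2) 0).
  ring: s5sq.
- apply: (modulo_uv (24 * (s5 - 1) * x ^+ 2 * y * z) (- 4 * d * z)).
  ring: s5sq.
Qed.
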